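(* Let $X=(X(t),t\in\mathbb{R})$ be a real-valued centered stationary Gaussian process with continuous sample paths, whose covariance function $R_X(t)=\mathrm{Cov}(X(0),X(t))$ is positive and satisfies $\int_0^\infty R_X(t)\,dt<\infty$. Then, with $\lambda$ the uniform (Lebesgue) probability measure on $[0,1]$, $$\lim_{a\to\infty}\frac1aC_X(a)=\Big(\lim_{a\to\infty}a\int_0^1\!\!\int_0^1R_X(a(u-v))\,\lambda(du)\lambda(dv)\Big)^{-1}=\frac{1}{2\int_0^\infty R_X(t)\,dt}.$$
   Context: For $a>0$, $C_X(a)$ is defined by $\lim_{u\to\infty}u^{-2}\log P(X(t)>u,\ 0\le t\le a)=-\frac12C_X(a)$; equivalently $C_X(a)=\big[\min_{\mu}\int_0^1\int_0^1R_X(a(u-v))\mu(du)\mu(dv)\big]^{-1}$, the minimum over Borel probability measures $\mu$ on $[0,1]$. *)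

(* Defs.v *)
From HB Require Import structures.
From mathcomp Require Import all_boot all_order all_algebra.
From mathcomp Require Import all_classical all_reals all_analysis.
Set Implicit Arguments. Unset Strict Implicit. Unset Printing Implicit Defensive.
Import Order.TTheory GRing.Theory Num.Theory.
Import numFieldNormedType.Exports.
Local Open Scope classical_set_scope.
Local Open Scope ring_scope.

Definition gaussian_rv d (T : measurableType d) (R : realType)
    (P : probability T R) (Y : T -> R) : Prop :=
  measurable_fun setT Y /\
  exists m s : R, forall A : set R, measurable A ->
    P (Y @^-1` A) = (if s == 0 then \d_m A else normal_prob m s A).

Definition gaussian_process d (T : measurableType d) (R : realType)
    (P : probability T R) (X : R -> {RV P >-> R}) : Prop :=
  forall (n : nat) (ts cs : 'I_n -> R),
    gaussian_rv P (fun w => \sum_(i < n) cs i * X (ts i) w).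

Definition centered d (T : measurableType d) (R : realType)
    (P : probability T R) (X : R -> {RV P >-> R}) : Prop :=
  forall t, ('E_P[X t] = 0)%E.

Definition cov_fun d (T : measurableType d) (R : realType)
    (P : probability T R) (X : R -> {RV P >-> R}) (t : R) : R :=
  fine (covariance P (X 0) (X t)).

(* Stationarity (for Gaussian processes, equivalent to strict stationarity):
   Cov(X(s), X(s+t)) does not depend on s. *)
Definition stationary d (T : measurableType d) (R : realType)
    (P : probability T R) (X : R -> {RV P >-> R}) : Prop :=
  forall s t, covariance P (X s) (X (s + t)) = covariance P (X 0) (X t).

Definition continuous_paths d (T : measurableType d) (R : realType)
    (P : probability T R) (X : R -> {RV P >-> R}) : Prop :=
  forall w : T, continuous (fun t : R => X t w).

Definition probs01 (R : realType) : set (probability R R) :=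
  [set mu : probability R R | mu `[0%R, 1%R]%classic = 1%E].

Definition energy (R : realType) (r : R -> R) (a : R) (mu : probability R R)
  : \bar R :=
  (\int[mu]_(u in `[0%R, 1%R]%classic) \int[mu]_(v in `[0%R, 1%R]%classic) (r (a * (u - v)))%:E)%E.

Definition C_fun (R : realType) (r : R -> R) (a : R) : R :=
  (fine (ereal_inf [set energy r a mu | mu in @probs01 R]))^-1.

Arguments gaussian_process {d T R} P X.
Arguments centered {d T R} P X.
Arguments cov_fun {d T R} P X t.
Arguments stationary {d T R} P X.
Arguments continuous_paths {d T R} P X.

(* Main.v *)
(** For a probability [mu] on the line write
    [E_a(mu,nu) = ∫∫ r(a(u-v)) mu(du) nu(dv)] and [Y_mu = ∫ X(au) mu(du)].
    Fubini gives [E_a(mu,nu) = E(Y_mu Y_nu)], so [E(Y_mu - Y_nu)^2 >= 0] yields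
    [E_a(mu,mu) >= 2 E_a(mu,nu) - E_a(nu,nu)].  Take [nu] uniform on [[-s,1+s]]
    and [mu] supported in [[0,1]]: by the change of variables [t = a(u-v)],
    [a(1+2s) E_a(mu,nu) >= ∫_{-as}^{as} r] and [a(1+2s) E_a(nu,nu) <= ∫ r].
    With [s = 1/sqrt a] this bounds [a E_a(mu,mu)] below, uniformly in [mu], by a
    quantity tending to [∫ r = 2 ∫_0^oo r], while the uniform measure on [[0,1]]
    satisfies [a E_a <= ∫ r].  The second moments of [X] are finite because [fine]
    sends infinite values to [0], whereas [r] is positive. *)

Require Import Defs.
From HB Require Import structures.
From mathcomp Require Import all_boot all_order all_algebra.
From mathcomp Require Import all_classical all_reals all_analysis.
From mathcomp Require Import measurable_realfun ring lra.
Import Order.TTheory GRing.Theory Num.Theory.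
Import numFieldNormedType.Exports.
Local Open Scope classical_set_scope.
Local Open Scope ring_scope.

(** * Averages of a process and positive semidefiniteness of its moment kernel *)

Lemma measurable_Rintegral_section {d d' : measure_display}
    {T : measurableType d} {S : measurableType d'} {R : realType}
    {P : probability T R} {mu : probability S R} {f : T * S -> R} :
  (P \x mu)%E.-integrable setT (EFin \o f) ->
  measurable_fun setT (fun w => \int[mu]_u f (w, u)).
Proof.
move=> fi; apply: (measurableT_comp (fine_measurable measurableT)).
exact: (measurable_fubini_F fi).
Qed.

(** A bound on the [g]-moment of every section passes to the average [Y] by the triangle inequality
    and Tonelli; the bound makes [f * g] integrable on the product, and Fubini exchanges the
    integrals. Two successive uses turn a double integral of the kernel into a moment of two
    averages. *)
Lemma Rintegral_section_mul {d d' : measure_display}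
    {T : measurableType d} {S : measurableType d'} {R : realType}
    {P : probability T R} {mu : probability S R} {f : T * S -> R} {g : T -> R}
    {M : R} :
  (P \x mu)%E.-integrable setT (EFin \o f) ->
  measurable_fun setT g ->
  (forall u, (\int[P]_w `|f (w, u) * g w|%:E <= M%:E)%E) ->
  let Y w := \int[mu]_u f (w, u) in
  [/\ P.-integrable setT (fun w => (Y w * g w)%:E),
      (\int[P]_w `|Y w * g w|%:E <= M%:E)%E &
      (\int[mu]_u \int[P]_w (f (w, u) * g w)%:E = \int[P]_w (Y w * g w)%:E)%E].
Proof.
move=> fi mg fgM Y.
have mf : measurable_fun setT f by move: (measurable_int _ fi) => /measurable_EFinP.
have mY : measurable_fun setT Y by exact: (measurable_Rintegral_section fi).
pose F (z : T * S) := (f z * g z.1)%:E.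
have mF : measurable_fun setT F.
  apply/measurable_EFinP; apply: measurable_funM => //.
  exact: measurableT_comp.
have FM : (\int[mu]_u \int[P]_w `|F (w, u)| <= M%:E)%E.
  apply: (@le_trans _ _ (\int[mu]_u (cst M%:E) u)%E).
    apply: ge0_le_integral => //.
    - by move=> u _; exact: integral_ge0.
    - apply: (measurable_fun_fubini_tonelli_G (abse \o F)) => //=.
      exact: measurableT_comp.
    - by move=> u _; exact: fgM.
  by rewrite integral_cst//= probability_setT mule1.
have Fi : (P \x mu)%E.-integrable setT F.
  by apply/integrable21ltyP => //; rewrite (le_lt_trans FM)// ltry.
(* [Y] is a [fine] value, so [g w] can be pulled out of the integral only where the section of [f]
   is integrable, that is, for almost every [w]. *)
have FY : ae_eq P setT (fubini_F mu F) (fun w => (Y w * g w)%:E).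
  have := ae_integrable1 fi; apply: filterS => w fw _.
  rewrite /fubini_F /F /Y /= EFinM.
  under eq_integral do rewrite EFinM.
  by rewrite integralZr// fineK// integrable_fin_num.
have mYg : measurable_fun setT (fun w => (Y w * g w)%:E).
  by apply/measurable_EFinP; exact: measurable_funM.
have mFF : measurable_fun setT (fubini_F mu F) by exact: (measurable_fubini_F Fi).
have YgM : (\int[P]_w `|Y w * g w|%:E <= M%:E)%E.
  apply: le_trans FM.
  rewrite -(fubini_tonelli (abse \o F))//=; last exact: measurableT_comp.
  rewrite -[leLHS]/(\int[P]_w (abse \o (fun w => (Y w * g w)%:E)) w)%E.
  rewrite -(@ae_eq_integral _ _ _ _ setT _ (abse \o fubini_F mu F))//.
  - apply: ge0_le_integral => //.
    + by move=> w _ /=.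
    + exact: measurableT_comp.
    + apply: (measurable_fun_fubini_tonelli_F (abse \o F)) => //=.
      exact: measurableT_comp.
    + move=> w _; apply: le_abse_integral => //.
      exact: (measurableT_comp mF).
  - exact: measurableT_comp.
  - exact: measurableT_comp.
  - by apply: filterS FY => w /= FYw _; rewrite /= FYw.
split => //.
- by apply/integrableP; split => //; rewrite (le_lt_trans YgM)// ltry.
- have <- := Fubini Fi.
  exact: ae_eq_integral.
Qed.

Lemma integral_cross_le {d : measure_display} {T : measurableType d} {R : realType}
    {P : probability T R} {y z : T -> R} :
  P.-integrable setT (fun w => (y w * y w)%:E) ->
  P.-integrable setT (fun w => (z w * z w)%:E) ->
  P.-integrable setT (fun w => (y w * z w)%:E) ->
  (2%:E * \int[P]_w (y w * z w)%:E <=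
   \int[P]_w (y w * y w)%:E + \int[P]_w (z w * z w)%:E)%E.
Proof.
move=> iy iz iyz; rewrite -integralD// -integralZl//.
apply: le_integral => //; [exact: integrableZl|exact: integrableD|].
move=> w _; rewrite -EFinM -EFinD lee_fin.
have := sqr_ge0 (y w - z w); rewrite sqrrB; lra.
Qed.

Definition mutual_energy {d : measure_display} {S : measurableType d} {R : realType}
    (k : S -> S -> \bar R) (m1 m2 : probability S R) : \bar R :=
  (\int[m1]_u \int[m2]_v k u v)%E.

(** The kernel [k] is a matrix of second moments, so the mutual energy of two laws is the moment
    E(Y1 Y2) of the corresponding averages, and the claim is E(Y1 - Y2)^2 >= 0. The uniform bound
    [M] supplies all the integrability. *)
Lemma mutual_energy_le {d d' : measure_display}
    {T : measurableType d} {S : measurableType d'} {R : realType}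
    {P : probability T R} (mu nu : probability S R) {f : T * S -> R} {M : R} :
  measurable_fun setT f ->
  (forall u, (\int[P]_w (f (w, u) ^+ 2)%:E <= M%:E)%E) ->
  let k u v := (\int[P]_w (f (w, u) * f (w, v))%:E)%E in
  is_true (2%:E * mutual_energy k mu nu <=
   mutual_energy k mu mu + mutual_energy k nu nu)%E.
Proof.
move=> mf fM k.
have mfu u : measurable_fun setT (fun w => f (w, u)).
  exact: measurableT_comp.
(* From |xy| <= x^2 + y^2. *)
have ffM u v : (\int[P]_w `|f (w, u) * f (w, v)|%:E <= (M + M)%:E)%E.
  have msq x : measurable_fun setT (fun w => (f (w, x) ^+ 2)%:E).
    by apply/measurable_EFinP; exact: measurable_funX.
  apply: (@le_trans _ _
    (\int[P]_w ((f (w, u) ^+ 2)%:E + (f (w, v) ^+ 2)%:E)))%E.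
    apply: ge0_le_integral => //.
    - apply/measurable_EFinP; apply: measurableT_comp => //.
      exact: measurable_funM.
    - exact: emeasurable_funD.
    - move=> w _; rewrite -EFinD lee_fin normrM.
      have := sqr_ge0 (`|f (w, u)| - `|f (w, v)|).
      rewrite sqrrB !real_normK ?num_real//.
      have := sqr_ge0 (f (w, u)); have := sqr_ge0 (f (w, v)).
      lra.
  rewrite ge0_integralD//; last 2 first.
    by move=> w _; rewrite lee_fin sqr_ge0.
    by move=> w _; rewrite lee_fin sqr_ge0.
  by rewrite EFinD leeD.
(* From |x| <= 1 + x^2, each section has absolute moment at most [1 + M]. *)
have fi (m : probability S R) : (P \x m)%E.-integrable setT (EFin \o f).
  apply/integrable21ltyP; first exact/measurable_EFinP.
  apply: (@le_lt_trans _ _ (1 + M)%:E); last by rewrite ltry.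
  apply: (@le_trans _ _ (\int[m]_u (cst (1 + M)%:E) u)%E); last first.
    by rewrite integral_cst//= probability_setT mule1.
  apply: ge0_le_integral => //.
  - by move=> u _; exact: integral_ge0.
  - apply: (measurable_fun_fubini_tonelli_G (abse \o (EFin \o f))) => //=.
    by apply: measurableT_comp => //; exact/measurable_EFinP.
  - move=> u _.
    apply: (@le_trans _ _ (\int[P]_w (1%:E + (f (w, u) ^+ 2)%:E)))%E.
      apply: ge0_le_integral => //.
      + by apply: measurableT_comp => //; exact/measurable_EFinP.
      + by apply/measurable_EFinP; apply: measurable_funD => //; exact: measurable_funX.
      + move=> w _; rewrite -EFinD lee_fin.
        have := sqr_ge0 (`|f (w, u)| - 1).
        rewrite sqrrB real_normK ?num_real// expr1n.
        have := sqr_ge0 (f (w, u)); lra.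
    rewrite ge0_integralD//; last 2 first.
      by move=> w _; rewrite lee_fin sqr_ge0.
      by apply/measurable_EFinP; exact: measurable_funX.
    by rewrite integral_cst//= probability_setT mule1 EFinD leeD.
pose Y (m : probability S R) w := \int[m]_u f (w, u).
have mY m : measurable_fun setT (Y m) by exact: (measurable_Rintegral_section (fi m)).
have fYM (m : probability S R) u :
    (\int[P]_w `|f (w, u) * Y m w|%:E <= (M + M)%:E)%E.
  have [_ + _] := Rintegral_section_mul (fi m) (mfu u) (fun v => ffM v u).
  by under eq_integral do rewrite mulrC.
(* The outer variable is averaged against the fixed factor [Y m2], then the inner one against the
   fixed section at [u]. *)
have EY m1 m2 : mutual_energy k m1 m2 = (\int[P]_w (Y m1 w * Y m2 w)%:E)%E.
  have [_ _ <-] := Rintegral_section_mul (fi m1) (mY m2) (fYM m2).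
  apply: eq_integral => u _.
  have [_ _] := Rintegral_section_mul (fi m2) (mfu u) (fun v => ffM v u).
  under eq_integral do under eq_integral do rewrite mulrC.
  by move=> ->; apply: eq_integral => w _; rewrite mulrC.
have iY m1 m2 : P.-integrable setT (fun w => (Y m1 w * Y m2 w)%:E).
  by have [] := Rintegral_section_mul (fi m1) (mY m2) (fYM m2).
by rewrite !EY; exact: integral_cross_le.
Qed.

(** * Joint measurability of a process with continuous paths *)

(** Rounding time down to the grid of step 1/(n+1) gives a process constant in time on countably
    many cells, hence jointly measurable; path continuity makes these converge pointwise. *)
Lemma measurable_of_continuous_paths {d : measure_display} {T : measurableType d}
    {R : realType} {X : R -> T -> R} :
  (forall t, measurable_fun setT (X t)) ->
  (forall w, continuous (fun t => X t w)) ->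
  measurable_fun setT (fun z : T * R => X z.2 z.1).
Proof.
move=> mX cX.
pose r n (t : R) : R := (Num.floor (n.+1%:R * t))%:~R / n.+1%:R.
apply: (@measurable_fun_cvg _ _ _ _ (fun n (z : T * R) => X (r n z.2) z.1)).
- move=> n _ B mB; rewrite setTI.
  have -> : (fun z : T * R => X (r n z.2) z.1) @^-1` B =
    \bigcup_(k in [set: int]) ((X (k%:~R / n.+1%:R) @^-1` B) `*`
       [set t : R | k%:~R <= n.+1%:R * t < (k + 1)%:~R]).
    apply/seteqP; split => [[w t] /= Bt|[w t] [k _ [/= Bk kt]]].
      by exists (Num.floor (n.+1%:R * t)) => //=; split => //; exact: floor_itv.
    by rewrite /r (floor_def kt).
  apply: countable_bigcupT_measurable => // k.
  apply: measurableX; first by rewrite -[X in measurable X]setTI; exact: mX.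
  have -> : [set t : R | k%:~R <= n.+1%:R * t < (k + 1)%:~R] =
      `[k%:~R / n.+1%:R, (k + 1)%:~R / n.+1%:R[%classic.
    apply/seteqP; split => t /=; rewrite in_itv/= ler_pdivrMr// ltr_pdivlMr//;
      by rewrite mulrC.
  exact: measurable_itv.
- move=> [w t] _ /=;  apply: (@continuous_cvg _ _ _ _ _ (fun n => r n t) (fun s => X s w)); first exact: cX.
  apply/cvgrPdist_le => e e0; near=> n.
  have n0 : 0 < n.+1%:R :> R by [].
  have /andP[h1 h2] := floor_itv (n.+1%:R * t).
  have h : n.+1%:R^-1 <= e.
    near: n; have := near_infty_natSinv_lt (PosNum e0).
    by apply: filterS => k /ltW.
  rewrite /r ger0_norm; last first.
    by rewrite subr_ge0 ler_pdivrMr// (mulrC t).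
  apply: le_trans h; rewrite lerBlDr -[leLHS](mulKf (lt0r_neq0 n0)).
  rewrite [_^-1 * _]mulrC -[X in _ <= X + _]mul1r -mulrDl ler_pM2r ?invr_gt0//.
  by apply: ltW; rewrite (lt_le_trans h2)// intrD addrC.
Unshelve. all: end_near. Qed.

(** * Lebesgue integrals on the line *)

(** The image of Lebesgue measure under [v] to [a * (u - v)], multiplied by [a], agrees with
    Lebesgue measure on half-open intervals, hence on all measurable sets. *)
Lemma ge0_integral_affine {R : realType} {f : R -> \bar R} {a : R} (u : R) :
  0 < a -> measurable_fun setT f -> (forall x, (0 <= f x)%E) ->
  (\int[lebesgue_measure]_v f (a * (u - v))%R =
   a^-1%:E * \int[lebesgue_measure]_v f v)%E.
Proof.
move=> a0 mf f0.
pose phi : measurableTypeR R -> measurableTypeR R := fun v : R => a * (u - v).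
have mphi : measurable_fun setT phi.
  by apply: (@measurable_funM _ _ R) => //; apply: (@measurable_funB _ _ R).
have ai0 : 0 <= a^-1 by rewrite invr_ge0 ltW.
have uniq (m : {measure set (measurableTypeR R) -> \bar R}) :
    (forall X, ocitv X -> lebesgue_measure X = a%:E * m X)%E ->
    forall A, measurable A -> (lebesgue_measure A = a%:E * m A)%E.
  exact: (@lebesgue_measure_unique R (mscale (NngNum (ltW a0)) m)).
have leb_phi (A : set R) : measurable A ->
    (a%:E * lebesgue_measure (phi @^-1` A) = lebesgue_measure A)%E.
  move=> mA; apply/esym.
  apply: (uniq (pushforward lebesgue_measure phi)) => //.
  move=> _ [[x y]] _ <-; rewrite /= /pushforward /=.
  (* The map is decreasing, so open and closed ends are exchanged. *)
  have -> : phi @^-1` `]x, y] = `[u - y / a, u - x / a[%classic.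
    apply/seteqP; split => v /=; rewrite !in_itv/= /phi;
    by rewrite lerBlDr ltrBrDr -lerBlDl -ltrBrDl ler_pdivlMr// ltr_pdivrMr// mulrC andbC.
  rewrite !lebesgue_measure_itv/= !lte_fin ltrD2l ltrN2 ltr_pM2r ?invr_gt0//.
  case: ifP => _; last by rewrite mule0.
  rewrite -!EFinD -EFinM; congr (_%:E); field; lra.
rewrite -[LHS]/(\int[lebesgue_measure]_(v in phi @^-1` setT) (f \o phi) v)%E.
rewrite -ge0_integral_pushforward// -(ge0_integral_mscale _ _ (NngNum ai0))//.
apply: eq_measure_integral => A mA _.
rewrite -[RHS]/(a^-1%:E * lebesgue_measure A)%E -(leb_phi A)//.
by rewrite muleA -EFinM mulVf ?gt_eqF// mul1e.
Qed.

Lemma ge0_integral_even {R : realType} {f : R -> \bar R} :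
  measurable_fun setT f -> (forall x, (0 <= f x)%E) -> (forall x, f (- x) = f x) ->
  (\int[lebesgue_measure]_x f x =
   2%:E * \int[lebesgue_measure]_(x in `[0%R, +oo[%classic) f x)%E.
Proof.
move=> mf f0 fN.
have mfS (D : set R) : measurable D -> measurable_fun D f.
  by move=> mD; exact: measurable_funS mf.
have <- : (`]-oo, 0%R[ `|` `[0%R, +oo[ = [set: R])%classic.
  apply/seteqP; split => x //= _; rewrite !in_itv/= andbT.
  by case: (ltP x 0); [left|right].
rewrite ge0_integral_setU//; last 2 first.
  - exact: (@measurable_funS _ _ _ _ setT).
  - apply/disj_setPS => x /=; rewrite !in_itv/= andbT => -[x0].
    by rewrite leNgt x0.
rewrite integral_itv_bndo_bndc; last exact: mfS.
rewrite (ge0_integration_by_substitution0 mf f0).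
under [X in (_ + X)%E]eq_integral do rewrite fN.
under [X in _ = (_ * X)%E]eq_integral do rewrite fN.
by rewrite -mule2n mule_natl.
Qed.

(** Monotonicity in [L] gives a limit along the reals; monotone convergence identifies it along the
    integers. *)
Lemma integral_symmetric_itv_cvg {R : realType} {f : R -> \bar R} :
  measurable_fun setT f -> (forall x, (0 <= f x)%E) ->
  (fun L : R => \int[lebesgue_measure]_(x in `[(- L)%R, L]%classic) f x)%E @ +oo -->
  (\int[lebesgue_measure]_x f x)%E.
Proof.
move=> mf f0.
have mfS (D : set R) : measurable D -> measurable_fun D f.
  by move=> mD; exact: measurable_funS mf.
have Jle (a b : R) : a <= b ->
    (\int[lebesgue_measure]_(x in `[(- a)%R, a]%classic) f x <=
     \int[lebesgue_measure]_(x in `[(- b)%R, b]%classic) f x)%E.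
  move=> ab; apply: ge0_subset_integral => //; first exact: mfS.
  by apply: subset_itv; rewrite bnd_simp ?lerN2.
have Jcvg : (fun n => \int[lebesgue_measure]_(x in `[(- n%:R)%R, n%:R%R]%classic) f x)%E @ \oo -->
    (\int[lebesgue_measure]_x f x)%E.
  have -> : [set: R] = \bigcup_n `[- n%:R, n%:R]%classic.
    apply/seteqP; split => x //= _; exists (Num.bound `|x|) => //=.
    by rewrite in_itv/= -ler_norml ltW// archi_boundP.
  apply: ge0_nondecreasing_set_cvg_integral => //.
  - move=> m n mn; apply/subsetPset; apply: subset_itv; rewrite bnd_simp ?lerN2 ler_nat//.
  - by move=> n; exact: mfS.
have supJ := nondecreasing_cvge Jle.
have natJ := cvg_comp _ _ (@cvgr_idn R) supJ.
by rewrite -(cvg_unique _ natJ Jcvg).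
Qed.

(** * Uniform laws on intervals *)

(** Stated through integrals of nonnegative functions, the only form in which uniformity is used
    below. *)
Definition uniform_on {R : realType} (p q : R) (nu : probability R R) : Prop :=
  forall f : R -> \bar R, measurable_fun setT f -> (forall x, (0 <= f x)%E) ->
    (\int[nu]_v f v =
     (q - p)^-1%:E * \int[lebesgue_measure]_(v in `[p, q]%classic) f v)%E.

Lemma uniform_on_exists {R : realType} {p q : R} : p < q ->
  exists nu, uniform_on p q nu.
Proof.
(* The identity carries the uniform law from [measurableTypeR R] to a law on [R]. *)
move=> pq; pose phi : measurableTypeR R -> R := idfun.
have mphi : measurable_fun setT phi by exact: measurable_id.
pose phi' : {mfun measurableTypeR R >-> R} :=
  HB.pack phi (isMeasurableFun.Build _ _ _ _ phi mphi).
exists (distribution (uniform_prob pq) phi') => f mf f0.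
by rewrite ge0_integral_pushforward//= integral_uniform.
Qed.

Lemma ge0_integral_support {d : measure_display} {S : measurableType d} {R : realType}
    {mu : probability S R} {D : set S} {f : S -> \bar R} :
  measurable D -> mu D = 1%E -> measurable_fun setT f -> (forall x, (0 <= f x)%E) ->
  (\int[mu]_(x in D) f x = \int[mu]_x f x)%E.
Proof.
move=> mD muD mf f0.
rewrite [RHS](@ge0_negligible_integral _ _ _ _ _ (~` D))//.
- by rewrite setTD setCK.
- exact: measurableC.
- by rewrite /= probability_setC// muD subee.
Qed.

(** * Energy bounds for the scaled kernel *)

Definition scaled_kernel {R : realType} (r : R -> R) (a u v : R) : \bar R :=
  (r (a * (u - v)))%:E.

Lemma measurable_scaled_kernel {R : realType} {r : R -> R} (a : R) :
  measurable_fun setT r ->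
  measurable_fun setT (fun z : R * R => scaled_kernel r a z.1 z.2).
Proof.
move=> mr; apply/measurable_EFinP; apply: (measurableT_comp mr).
by apply: measurable_funM => //; exact: measurable_funB.
Qed.

Lemma measurable_potential {R : realType} {r : R -> R} (a : R) (nu : probability R R) :
  measurable_fun setT r -> (forall t, 0 <= r t) ->
  measurable_fun setT (fun u => \int[nu]_v scaled_kernel r a u v)%E.
Proof.
move=> mr r0.
apply: (measurable_fun_fubini_tonelli_F
  (fun z : R * R => scaled_kernel r a z.1 z.2)).
- exact: measurable_scaled_kernel.
- by move=> z; rewrite lee_fin.
Qed.

(** Dropping the restriction to [0,1] allows comparison with laws charging a larger interval. *)
Lemma energy_mutual {R : realType} {r : R -> R} (a : R) {mu : probability R R} :
  measurable_fun setT r -> (forall t, 0 <= r t) -> probs01 mu ->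
  energy r a mu = mutual_energy (scaled_kernel r a) mu mu.
Proof.
move=> mr r0 mu01.
have mk u : measurable_fun setT (scaled_kernel r a u).
  exact: (measurable_fun_pair2 u (measurable_scaled_kernel a mr)).
rewrite /energy /mutual_energy -(ge0_integral_support _ mu01)//.
- apply: eq_integral => u _; apply: (ge0_integral_support _ mu01 (mk u)) => //.
  by move=> v; rewrite lee_fin.
- exact: (measurable_potential a _ mr r0).
- by move=> u; apply: integral_ge0 => v _; rewrite lee_fin.
Qed.

(** For each [u], enlarging [p,q] to the whole line bounds the inner integral by [K / a], before
    normalization. Used with [mu] equal to [nu], on both the enlarged interval and [0,1]. *)
Lemma mutual_energy_uniform_le {R : realType} {r : R -> R} {K a p q : R}
    (mu : probability R R) {nu : probability R R} :
  measurable_fun setT r -> (forall t, 0 <= r t) ->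
  (\int[lebesgue_measure]_t (r t)%:E = K%:E)%E -> 0 < a -> p < q ->
  uniform_on p q nu ->
  (mutual_energy (scaled_kernel r a) mu nu <= (K / (a * (q - p)))%:E)%E.
Proof.
move=> mr r0 rK a0 pq unu.
have mk u : measurable_fun setT (scaled_kernel r a u).
  exact: (measurable_fun_pair2 u (measurable_scaled_kernel a mr)).
apply: (@le_trans _ _ (\int[mu]_u (cst (K / (a * (q - p)))%:E) u)%E); last first.
  by rewrite integral_cst//= probability_setT mule1.
apply: ge0_le_integral => //.
- by move=> u _; apply: integral_ge0 => v _; rewrite lee_fin.
- exact: (measurable_potential a _ mr r0).
- move=> u _; rewrite unu//; last by move=> v; rewrite lee_fin.
  apply: (@le_trans _ _ ((q - p)^-1%:E * \int[lebesgue_measure]_v scaled_kernel r a u v)%E).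
    rewrite lee_pmul2l ?lte_fin ?invr_gt0 ?subr_gt0//.
    by apply: ge0_subset_integral => //; [exact: mk|move=> v _; rewrite lee_fin].
  have -> := ge0_integral_affine u a0 (proj2 (measurable_EFinP _ _) mr) r0.
  by rewrite rK -!EFinM lee_fin invfM mulrA [leRHS]mulrC [_^-1 * _]mulrC.
Qed.

(** For [u] in [0,1] the window [u-s,u+s] lies inside [-s,1+s], so the inner integral captures all
    of [r] on [-as,as]. This is why the uniform law is spread beyond [0,1]. *)
Lemma mutual_energy_uniform_ge {R : realType} {r : R -> R} {J a s : R}
    {mu nu : probability R R} :
  measurable_fun setT r -> (forall t, 0 <= r t) ->
  (\int[lebesgue_measure]_(t in `[(- (a * s))%R, (a * s)%R]%classic) (r t)%:E = J%:E)%E ->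
  0 < a -> 0 < s -> probs01 mu -> uniform_on (- s) (1 + s) nu ->
  ((J / (a * (1 + 2 * s)))%:E <= mutual_energy (scaled_kernel r a) mu nu)%E.
Proof.
move=> mr r0 rJ a0 s0 mu01 unu.
have mk u : measurable_fun setT (scaled_kernel r a u).
  exact: (measurable_fun_pair2 u (measurable_scaled_kernel a mr)).
set c := J / _.
rewrite /mutual_energy -(ge0_integral_support _ mu01)//; last 2 first.
- exact: (measurable_potential a _ mr r0).
- by move=> u; apply: integral_ge0 => v _; rewrite lee_fin.
have J0 : 0 <= J by rewrite -lee_fin -rJ; apply: integral_ge0 => v _; rewrite lee_fin.
have s1 : 0 < 1 + 2 * s by lra.
have c0 : 0 <= c by apply: divr_ge0 => //; apply: mulr_ge0; exact: ltW.
apply: (@le_trans _ _ (\int[mu]_(u in `[0%R, 1%R]%classic) (cst c%:E) u)%E).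
  by rewrite integral_cst//= mu01 mule1.
apply: ge0_le_integral => //.
- by apply: (measurable_funS measurableT) => //; exact: (measurable_potential a _ mr r0).
- move=> u /=; rewrite in_itv/= => /andP[u0 u1]; rewrite unu//; last by move=> v; rewrite lee_fin.
  have -> : 1 + s - - s = 1 + 2 * s by ring.
  have -> : c%:E = ((1 + 2 * s)^-1%:E * (a^-1%:E * J%:E))%E.
    by rewrite -!EFinM /c invfM; congr (_%:E); ring.
  rewrite lee_pmul2l ?lte_fin ?invr_gt0//.
  (* Cutting [r] off outside the window turns [J] into an integral over the whole line, to which the
     affine substitution applies. *)
  have mrJ : measurable_fun setT
      ((EFin \o r) \_ `[(- (a * s))%R, (a * s)%R]%classic).
    apply: (proj1 (measurable_restrictT _ (measurable_itv _))).
    by apply: (@measurable_funS _ _ _ _ setT) => //; exact/measurable_EFinP.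
  rewrite -rJ integral_mkcond -(ge0_integral_affine u a0 mrJ); last first.
    by move=> x; rewrite patchE; case: ifP => // _; rewrite lee_fin.
  rewrite [leRHS]integral_mkcond; apply: ge0_le_integral => //.
  - by move=> x _; rewrite patchE; case: ifP => // _; rewrite lee_fin.
  - apply: (measurableT_comp mrJ).
    by apply: (@measurable_funM _ _ R) => //; exact: (@measurable_funB _ _ R).
  - apply: (proj1 (measurable_restrictT _ (measurable_itv _))).
    exact: (@measurable_funS _ _ _ _ setT).
  - move=> v _; rewrite !patchE; case: ifPn => // hv; last first.
      by case: ifP => // _; rewrite lee_fin.
    rewrite ifT//; move: hv; rewrite !inE/= !in_itv/= => /andP[h1 h2].
    have h3 : u - v <= s by rewrite -(ler_pM2l a0).
    have h4 : - s <= u - v by rewrite -(ler_pM2l a0) mulrN.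
    lra.
Qed.

(** Twice the lower bound on the cross energy minus the upper bound on the energy of the uniform
    law; the result does not depend on [mu], so it bounds the infimum. *)
Lemma energy_ge {R : realType} {r : R -> R} {K J a s : R} {mu : probability R R} :
  measurable_fun setT r -> (forall t, 0 <= r t) ->
  (forall m1 m2 : probability R R,
    2%:E * mutual_energy (scaled_kernel r a) m1 m2 <=
    mutual_energy (scaled_kernel r a) m1 m1 +
    mutual_energy (scaled_kernel r a) m2 m2)%E ->
  (\int[lebesgue_measure]_t (r t)%:E = K%:E)%E ->
  (\int[lebesgue_measure]_(t in `[(- (a * s))%R, (a * s)%R]%classic) (r t)%:E = J%:E)%E ->
  0 < a -> 0 < s -> probs01 mu ->
  (((2 * J - K) / (a * (1 + 2 * s)))%:E <= energy r a mu)%E.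
Proof.
move=> mr r0 pd rK rJ a0 s0 mu01.
have s1 : - s < 1 + s by lra.
have [nu unu] := uniform_on_exists s1.
have lb := mutual_energy_uniform_ge mr r0 rJ a0 s0 mu01 unu.
have := mutual_energy_uniform_le nu mr r0 rK a0 s1 unu.
have -> : 1 + s - - s = 1 + 2 * s by ring.
move=> ub; rewrite (energy_mutual a mr r0 mu01).
have h : (2%:E * (J / (a * (1 + 2 * s)))%:E <=
    mutual_energy (scaled_kernel r a) mu mu + (K / (a * (1 + 2 * s)))%:E)%E.
  apply: (le_trans _ (le_trans (pd mu nu) _)).
    by rewrite lee_pmul2l// lte_fin.
  by rewrite leeD2l.
by rewrite mulrBl EFinB leeBlDr// -mulrA EFinM.
Qed.

(** Makes the double Lebesgue integral the energy of an admissible law, hence an upper bound for the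
    infimum. *)
Lemma energy_uniform01 {R : realType} {r : R -> R} (a : R) {nu : probability R R} :
  measurable_fun setT r -> (forall t, 0 <= r t) -> uniform_on 0 1 nu ->
  probs01 nu /\
  (energy r a nu = \int[lebesgue_measure]_(u in `[0%R, 1%R]%classic)
     \int[lebesgue_measure]_(v in `[0%R, 1%R]%classic) (r (a * (u - v)))%:E)%E.
Proof.
move=> mr r0 unu.
have nu01 : probs01 nu.
  rewrite /probs01/=.
  have := unu (EFin \o \1_(`[0, 1]%classic : set R)).
  rewrite integral_indic// setIT => ->.
  - rewrite subr0 invr1 mul1e integral_indic//= setIid lebesgue_measure_itv/=.
    by rewrite lte_fin ltr01 oppr0 adde0.
  - by apply/measurable_EFinP; exact: measurable_indic.
  - by move=> x; rewrite lee_fin.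
split => //; rewrite (energy_mutual a mr r0 nu01) /mutual_energy unu.
- rewrite subr0 invr1 mul1e; apply: eq_integral => u _.
  rewrite unu ?subr0 ?invr1 ?mul1e//.
  + exact: (measurable_fun_pair2 u (measurable_scaled_kernel a mr)).
  + by move=> v; rewrite lee_fin.
- exact: (measurable_potential a _ mr r0).
- by move=> u; apply: integral_ge0 => v _; rewrite lee_fin.
Qed.

(** * Passage to the limit *)

Lemma sqrt_cvgy {R : realType} : @Num.sqrt R a @[a --> +oo] --> +oo.
Proof.
apply/cvgryPge => A; near=> a.
rewrite (le_trans (ler_norm A))// -sqrtr_sqr ler_wsqrtr//.
Unshelve. all: by end_near. Qed.

(** One chain gives both limits: [a] times the infimum and [a] times the uniform energy lie, in this
    order, between a function tending to [K] and [K] itself. *)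
Lemma energy_limits {R : realType} {r : R -> R} {K : R} :
  measurable_fun setT r -> (forall t, 0 <= r t) ->
  (forall a (m1 m2 : probability R R),
    2%:E * mutual_energy (scaled_kernel r a) m1 m2 <=
    mutual_energy (scaled_kernel r a) m1 m1 +
    mutual_energy (scaled_kernel r a) m2 m2)%E ->
  (\int[lebesgue_measure]_t (r t)%:E = K%:E)%E ->
  (fun a => a * fine (ereal_inf [set energy r a mu | mu in @probs01 R])) @ +oo --> K /\
  (fun a => a * fine (\int[lebesgue_measure]_(u in `[0%R, 1%R]%classic)
     \int[lebesgue_measure]_(v in `[0%R, 1%R]%classic) (r (a * (u - v)))%:E)%E)
    @ +oo --> K.
Proof.
move=> mr r0 pd rK.
pose m a := ereal_inf [set energy r a mu | mu in @probs01 R].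
pose F a := (\int[lebesgue_measure]_(u in `[0%R, 1%R]%classic)
     \int[lebesgue_measure]_(v in `[0%R, 1%R]%classic) (r (a * (u - v)))%:E)%E.
pose JE L := (\int[lebesgue_measure]_(t in `[(- L)%R, L]%classic) (r t)%:E)%E.
pose J L := fine (JE L).
have JEcvg : JE @ +oo --> K%:E.
  rewrite -rK; apply: (@integral_symmetric_itv_cvg _ (EFin \o r)) => //.
  exact/measurable_EFinP.
have JEfin L : JE L = (J L)%:E.
  rewrite /J fineK// ge0_fin_numE; last first.
    by apply: integral_ge0 => t _; rewrite lee_fin.
  apply: (@le_lt_trans _ _ K%:E); last by rewrite ltry.
  rewrite -rK; apply: ge0_subset_integral => //; first exact/measurable_EFinP.
  by move=> t _; rewrite lee_fin.
have Jcvg : J @ +oo --> K by exact: fine_cvg JEcvg.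
(* This is [a] times the bound of [energy_ge] at s = 1/sqrt a: the window a s = sqrt a grows while s
   tends to 0. *)
pose g (a : R) := (2 * J (Num.sqrt a) - K) / (1 + 2 * (Num.sqrt a)^-1).
have gcvg : g @ +oo --> K.
  have -> : K = (2 * K - K) / (1 + 2 * 0) by field.
  apply: cvgM.
    apply: cvgB; last exact: cvg_cst.
    by apply: cvgMr; exact: (cvg_comp _ _ sqrt_cvgy Jcvg).
  apply: cvgV; first by rewrite mulr0 addr0.
  apply: cvgD; first exact: cvg_cst.
  apply: cvgMr; apply/gtr0_cvgV0; last exact: sqrt_cvgy.
  by near=> a; rewrite sqrtr_gt0; near: a; exact: nbhs_pinfty_gt.
have key a : 0 < a -> [/\ g a <= a * fine (m a), a * fine (m a) <= a * fine (F a) &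
    a * fine (F a) <= K].
  move=> a0.
  have [nu unu] := uniform_on_exists (@ltr01 R).
  have [nu01 nuF] := energy_uniform01 a mr r0 unu.
  have FK : (F a <= (K / a)%:E)%E.
    rewrite /F -nuF (energy_mutual a mr r0 nu01).
    have := mutual_energy_uniform_le nu mr r0 rK a0 ltr01 unu.
    by rewrite subr0 mulr1.
  have mF : (m a <= F a)%E by rewrite /F -nuF; apply: ereal_inf_lbound; exists nu.
  have s0 : 0 < Num.sqrt a by rewrite sqrtr_gt0.
  have s1 : 0 < (Num.sqrt a)^-1 by rewrite invr_gt0.
  have asE : a * (Num.sqrt a)^-1 = Num.sqrt a.
    by rewrite -[X in X / _](sqr_sqrtr (ltW a0)) expr2 mulfK// gt_eqF.
  have gm : ((g a / a)%:E <= m a)%E.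
    apply: le_ereal_inf_tmp => _ [mu mu01 <-].
    have rJ := JEfin (Num.sqrt a); rewrite /JE -asE in rJ.
    have := energy_ge mr r0 (pd a) rK rJ a0 s1 mu01.
    by rewrite asE /g invfM mulrA mulrAC.
  (* Finiteness excludes the default value 0 of [fine], so the extended inequalities transfer to the
     reals. *)
  have mfin : m a \is a fin_num.
    rewrite fin_numE; apply/andP; split.
    - by apply/eqP => mE; rewrite mE in gm.
    - by apply/eqP => mE; move: (le_trans mF FK); rewrite mE.
  have Ffin : F a \is a fin_num.
    rewrite fin_numE; apply/andP; split.
    - by apply/eqP => FE; move: (le_trans gm mF); rewrite FE.
    - by apply/eqP => FE; rewrite FE in FK.
  split.
  - by rewrite mulrC -ler_pdivrMr// -lee_fin fineK.
  - by rewrite ler_pM2l// fine_le.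
  - by rewrite mulrC -ler_pdivlMr// -lee_fin fineK.
split.
- apply: (squeeze_cvgr _ gcvg (cvg_cst K)).
  near=> a; have [|h1 h2 h3] := key a; first by near: a; exact: nbhs_pinfty_gt.
  by rewrite h1 (le_trans h2).
- apply: (squeeze_cvgr _ gcvg (cvg_cst K)).
  near=> a; have [|h1 h2 h3] := key a; first by near: a; exact: nbhs_pinfty_gt.
  by rewrite (le_trans h1).
Unshelve. all: by end_near. Qed.

(** * Covariance of the process and conclusion *)

(** The integrand is signed and not assumed integrable, so Tonelli is applied to its positive and
    negative parts separately. *)
Lemma measurable_integral_section {d d' : measure_display}
    {T : measurableType d} {S : measurableType d'} {R : realType}
    (P : probability T R) {f : T * S -> \bar R} :
  measurable_fun setT f -> measurable_fun setT (fun u => \int[P]_w f (w, u))%E.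
Proof.
move=> mf.
have -> : (fun u => \int[P]_w f (w, u))%E =
    (fubini_G P f^\+ \- fubini_G P f^\-)%E.
  apply/funext => u; rewrite [LHS]integralE /fubini_G.
  under eq_integral do rewrite funepos_comp/=.
  by under [X in (_ - X)%E = _]eq_integral do rewrite funeneg_comp/=.
apply: emeasurable_funB; apply: measurable_fun_fubini_tonelli_G => //.
- exact: measurable_funepos.
- exact: measurable_funeneg.
Qed.

Theorem theorem7p1 (d : measure_display) (T : measurableType d) (R : realType)
    (P : probability T R) (X : R -> {RV P >-> R}) :
  gaussian_process P X -> centered P X -> stationary P X ->
  continuous_paths P X ->
  (forall t, 0 < cov_fun P X t) ->
  (\int[lebesgue_measure]_(t in `[0%R, +oo[%classic) (cov_fun P X t)%:E < +oo)%E ->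
  let I := fine (\int[lebesgue_measure]_(t in `[0%R, +oo[%classic) (cov_fun P X t)%:E)%E in
  (fun a : R => C_fun (cov_fun P X) a / a) @ +oo --> (2 * I)^-1 /\
  (fun a : R => a * fine (\int[lebesgue_measure]_(u in `[0%R, 1%R]%classic)
      \int[lebesgue_measure]_(v in `[0%R, 1%R]%classic) (cov_fun P X (a * (u - v)))%:E)%E)
    @ +oo --> 2 * I.
Proof.
move=> _ X0 Xst Xc r_gt0 ri I.
set r := cov_fun P X in r_gt0 ri I *.
have covE s t : (covariance P (X s) (X t) = \int[P]_w (X s w * X t w)%:E)%E.
  rewrite unlock !X0 unlock; apply: eq_integral => w _.
  by congr (_%:E); rewrite /= -[LHS]/((X s w - 0) * (X t w - 0)) !subr0.
have r0 t : 0 <= r t by exact: ltW.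
(* Stationarity reduces to lag [t - s], where an infinite covariance would give [r] the value 0. *)
have cov_fin s t : covariance P (X s) (X t) \is a fin_num.
  rewrite -[t](subrKC s) Xst; move: (r_gt0 (t - s)); rewrite /r /cov_fun.
  by case: (covariance P (X 0) _) => //=; rewrite ltxx.
pose M := r 0.
have X2 t : (\int[P]_w (X t w ^+ 2)%:E <= M%:E)%E.
  under eq_integral do rewrite expr2.
  have := Xst t 0; rewrite addr0 covE => ->.
  by rewrite /M /r /cov_fun fineK.
have mX : measurable_fun setT (fun z : T * R => X z.2 z.1).
  by apply: (@measurable_of_continuous_paths _ _ _ (fun t => X t)).
have covr s t : (\int[P]_w (X s w * X t w)%:E = (r (s - t))%:E)%E.
  rewrite -covE covarianceC -{1}[s](subrKC t) Xst.
  by rewrite /r /cov_fun fineK.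
have rN t : r (- t) = r t.
  have := covr 0 t; rewrite sub0r => /esym h.
  have h2 := covr t 0; rewrite subr0 in h2.
  apply/EFin_inj; rewrite h -h2; apply: eq_integral => w _.
  by rewrite mulrC.
(* Joint measurability of the process makes [r] measurable as a partial integral. *)
have mr : measurable_fun setT r.
  have -> : r = fine \o (fun t => \int[P]_w (X 0 w * X t w)%:E)%E.
    by apply/funext => t; rewrite /= -covE.
  apply: (measurableT_comp (fine_measurable measurableT)).
  apply: (measurable_integral_section P (f := fun z => (X 0 z.1 * X z.2 z.1)%:E)).
  apply/measurable_EFinP; apply: measurable_funM => //.
  exact: measurableT_comp.
(* The scaled kernel is the covariance of the process [u] to [X (a * u)]. *)
have pd a (m1 m2 : probability R R) :
    (2%:E * mutual_energy (scaled_kernel r a) m1 m2 <=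
    mutual_energy (scaled_kernel r a) m1 m1 +
    mutual_energy (scaled_kernel r a) m2 m2)%E.
  have -> : scaled_kernel r a = (fun u v => \int[P]_w (X (a * u) w * X (a * v) w)%:E)%E.
    apply/funext => u; apply/funext => v.
    by rewrite /scaled_kernel covr -mulrBr.
  apply: (@mutual_energy_le _ _ _ _ _ P m1 m2 (fun z => X (a * z.2) z.1) M).
  - apply: (measurableT_comp mX (g := fun z => (z.1, a * z.2))).
    apply: measurable_fun_pair => //; exact: measurable_funM.
  - by move=> u; exact: (X2 (a * u)).
have Ifin : (\int[lebesgue_measure]_(t in `[0%R, +oo[%classic) (r t)%:E = I%:E)%E.
  by rewrite /I fineK// ge0_fin_numE//; apply: integral_ge0 => t _; rewrite lee_fin.
have rK : (\int[lebesgue_measure]_t (r t)%:E = (2 * I)%:E)%E.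
  rewrite (@ge0_integral_even _ (EFin \o r))//.
  - by rewrite EFinM -Ifin.
  - exact/measurable_EFinP.
  - by move=> x /=; rewrite rN.
(* Needed to invert the limit. If [I] were 0, the positive function [r] would vanish almost
   everywhere on a half-line of infinite measure. *)
have I0 : I != 0.
  apply/eqP => I0; rewrite I0 in Ifin.
  have : ae_eq lebesgue_measure `[0%R, +oo[%classic (EFin \o r) (cst 0%E).
    apply/ae_eq_integral_abs => //.
      apply: (@measurable_funS _ _ _ _ setT) => //; exact/measurable_EFinP.
    apply: etrans Ifin; apply: eq_integral => t _.
    by rewrite /= ger0_norm.
  move=> [N [mN N0 Nsub]].
  have : (lebesgue_measure (`[0%R, +oo[%classic : set R) <= lebesgue_measure N)%E.
    apply: le_measure; rewrite ?inE//.
    move=> t /= t0; apply: Nsub => /= /(_ t0) [] rt.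
    by move: (r_gt0 t); rewrite rt ltxx.
  by rewrite N0 lebesgue_measure_itv/= ltry oppr0 adde0 leye_eq.
have [lim_min lim_unif] := energy_limits mr r0 pd rK.
split => //.
(* Valid for every [a], including 0, since the inverse of 0 is 0. *)
have -> : (fun a => C_fun r a / a) =
    (fun a => (a * fine (ereal_inf [set energy r a mu | mu in @probs01 R]))^-1).
  by apply/funext => a; rewrite /C_fun invfM mulrC.
by apply: cvgV => //; rewrite mulf_neq0.
Qed.
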